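(* Let $\mathbb{K}$ be a field of characteristic $0$, let $I$ and $J$ be monomial ideals in $\mathbb{K}[\mathbf{x}]=\mathbb{K}[x_1,\ldots,x_n]$, and let $\mathbf{a}\in\mathbb{N}^n$ be a vector whose coordinates are sufficiently large (depending on $I$ and $J$). Then $$ I * J \;=\; \bigl(I^{[\mathbf{a}]}\cdot J^{[\mathbf{a}]}\bigr)^{[2\mathbf{a}]}\quad\text{modulo}\quad \mathbf{m}^{\mathbf{a}+\mathbf{1}},$$ where $\mathbf{1}=(1,1,\ldots,1)$ and the operation ''modulo $\mathbf{m}^{\mathbf{a}+\mathbf{1}}$'' removes all the monomial generators that are divisible by $x_i^{a_i+1}$ for some $i$.
   Context: Join: for ideals $I,J\subset\mathbb{K}[\mathbf{x}]$, introduce new variables $\mathbf{y}_1=(y_{11},\ldots,y_{1n})$, $\mathbf{y}_2=(y_{21},\ldots,y_{2n})$, let $I(\mathbf{y}_1)$, $J(\mathbf{y}_2)$ be the images of $I$, $J$ in $\mathbb{K}[\mathbf{x},\mathbf{y}_1,\mathbf{y}_2]$ under $\mathbf{x}\mapsto\mathbf{y}_1$, $\mathbf{x}\mapsto\mathbf{y}_2$, respectively. Then $$I*J=\bigl(I(\mathbf{y}_1)+J(\mathbf{y}_2)+\langle y_{1i}+y_{2i}-x_i : 1\le i\le n\rangle\bigr)\cap\mathbb{K}[\mathbf{x}].$$ Irreducible monomial ideals: for $\mathbf{u}\in\mathbb{N}^n$, $\mathbf{m}^{\mathbf{u}}=\langle x_i^{u_i} : u_i>0\rangle$. Alexander duality: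 let $I$ be a monomial ideal all of whose minimal generators divide $\mathbf{x}^{\mathbf{a}}=x_1^{a_1}\cdots x_n^{a_n}$. For $\mathbf{b}\le\mathbf{a}$ let $\mathbf{a}\smallsetminus\mathbf{b}$ be the vector with $i$-th coordinate $a_i+1-b_i$ if $b_i\ge 1$ and $0$ if $b_i=0$. The Alexander dual of $I$ with respect to $\mathbf{a}$ is $$I^{[\mathbf{a}]}=\bigcap\{\mathbf{m}^{\mathbf{a}\smallsetminus\mathbf{b}} : \mathbf{x}^{\mathbf{b}}\text{ is a minimal generator of } I\}.$$ ''Modulo $\mathbf{m}^{\mathbf{a}+\mathbf{1}}$'': for a monomial ideal $L$, ''$L$ modulo $\mathbf{m}^{\mathbf{a}+\mathbf{1}}$'' is the monomial ideal generated by those minimal monomial generators of $L$ that are not divisible by $x_i^{a_i+1}$ for any $i$. ''Sufficiently large'' means that there is a vector $\mathbf{a}_0\in\mathbb{N}^n$ such that the assertion holds for all $\mathbf{a}\ge\mathbf{a}_0$ coordinatewise. *)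

(* Defs.v *)
From mathcomp Require Import all_boot all_order all_algebra.
From mathcomp Require Import boolp classical_sets.
From mathcomp Require Import mpoly.

Set Implicit Arguments.
Unset Strict Implicit.
Unset Printing Implicit Defensive.

Import GRing.Theory.
Local Open Scope classical_set_scope.
Local Open Scope ring_scope.

(* Ideals are Prop-valued sets, so that membership need not be decidable.
   [idealr_closed] of ring_quotient is not used because it excludes the unit
   ideal, which does occur below. *)
Definition is_ideal (R : comNzRingType) (A : set R) : Prop :=
  [/\ A 0,
      forall f g, A f -> A g -> A (f + g)
    & forall f g, A g -> A (f * g)].

Definition ideal_gen (R : comNzRingType) (G : set R) : set R :=
  smallest (@is_ideal R) G.

Definition ideal_add (R : comNzRingType) (A B : set R) : set R :=
  [set f + g | f in A & g in B].

Definition ideal_mul (R : comNzRingType) (A B : set R) : set R :=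
  ideal_gen [set f * g | f in A & g in B].

Section Join.
Variables (K : fieldType) (n : nat).

(* K[x, y1, y2] is {mpoly K[n + (n + n)]}, the three blocks of n variables
   being x, y1 and y2 in this order. *)
Definition xvar (i : 'I_n) : {mpoly K[n + (n + n)]} := 'X_(lshift (n + n) i).
Definition y1var (i : 'I_n) : {mpoly K[n + (n + n)]} :=
  'X_(rshift n (lshift n i)).
Definition y2var (i : 'I_n) : {mpoly K[n + (n + n)]} :=
  'X_(rshift n (rshift n i)).

(* The K-algebra morphism K[x] -> K[x, y1, y2] mapping x_i to v i. *)
Definition subst_vars (v : 'I_n -> {mpoly K[n + (n + n)]})
    (f : {mpoly K[n]}) : {mpoly K[n + (n + n)]} :=
  f \mPo [tuple v i | i < n].

(* The ideal of K[x, y1, y2] generated by the image of A under x_i |-> v i: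
   the image alone is not an ideal. *)
Definition ideal_subst (v : 'I_n -> {mpoly K[n + (n + n)]})
    (A : set {mpoly K[n]}) : set {mpoly K[n + (n + n)]} :=
  ideal_gen (subst_vars v @` A).

(* The intersection with K[x] is the preimage under the inclusion of K[x] in
   K[x, y1, y2]. *)
Definition ideal_join (I J : set {mpoly K[n]}) : set {mpoly K[n]} :=
  subst_vars xvar @^-1`
    ideal_add (ideal_add (ideal_subst y1var I) (ideal_subst y2var J))
      (ideal_gen [set y1var i + y2var i - xvar i | i in [set: 'I_n]]).

End Join.

Section MonomialIdeals.
Variables (K : fieldType) (n : nat).
Implicit Types (I L : set {mpoly K[n]}) (a b u m : 'X_{1..n}).

(* On 'X_{1..n}, the order (_ <= _)%MM is the coordinatewise one, that is
   divisibility of monomials; (_ <= _)%O would be a monomial order. *)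

Definition monomial_ideal I : Prop :=
  exists S : set 'X_{1..n}, I = ideal_gen [set 'X_[m] | m in S].

Definition min_gens I : set 'X_{1..n} :=
  [set m | I 'X_[m] /\
           forall m', I 'X_[m'] -> (m' <= m)%MM -> m' = m].

Definition irr_ideal u : set {mpoly K[n]} :=
  ideal_gen [set 'X_i ^+ u i | i in [set i : 'I_n | (0 < u i)%N]].

(* Only meaningful for b <= a; the subtraction is truncated otherwise. *)
Definition mnm_dual a b : 'X_{1..n} :=
  [multinom (if b i == 0 then 0 else a i + 1 - b i)%N | i < n].

(* Only meaningful when all the minimal generators of I divide 'X_[a].  For
   I = 0 the empty intersection is the unit ideal. *)
Definition alexander_dual a I : set {mpoly K[n]} :=
  \bigcap_(b in min_gens I) irr_ideal (mnm_dual a b).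

(* L modulo m^(a + 1). *)
Definition ideal_modulo a L : set {mpoly K[n]} :=
  ideal_gen [set 'X_[m] | m in
    [set m | min_gens L m /\ forall i, ~~ ((U_(i) *+ (a i + 1)) <= m)%MM]].

End MonomialIdeals.

(* Main.v *)
(* A monomial ideal is determined by the upward closed set of its exponents. For
   exponent sets U of I and V of J, expanding (y1 + y2)^m, whose coefficients are
   nonzero in characteristic 0, shows that the join has the exponents m such that
   every splitting m = b + c satisfies U b or V c. If a bounds the minimal elements
   of U, the dual with respect to a has the exponents m such that a - m (truncated)
   is not in U. Hence, for m <= a, m is in the dual of the product iff every p and
   q with p + q <= 2a - m satisfy U (a - p) or V (a - q), which is the same
   condition with b = a - p and c = a - q. By Dickson's lemma, all minimal elements
   involved are <= a as soon as a is large. *)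

Require Import Defs.
From mathcomp Require Import all_boot all_order all_algebra.
From mathcomp Require Import boolp classical_sets.
From mathcomp Require Import mpoly.
From mathcomp Require Import zify ring.

Set Implicit Arguments.
Unset Strict Implicit.
Unset Printing Implicit Defensive.

Import GRing.Theory.
Local Open Scope classical_set_scope.
Local Open Scope ring_scope.

(** * Ideals as sets: generation, sums, preimages *)

Section Ideals.
Variable R : comNzRingType.
Implicit Types (A B G : set R).

Lemma ideal_gen_is_ideal G : is_ideal (ideal_gen G).
Proof.
split=> [A [[]]//|f g Gf Gg A [iA sA]|f g Gg A [iA sA]].
  by case: (iA) => _ + _; apply; [apply: Gf|apply: Gg].
by case: (iA) => _ _; apply; apply: Gg.
Qed.

Lemma ideal_gen_sub A G : is_ideal A -> G `<=` A -> ideal_gen G `<=` A.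
Proof. exact: smallest_sub. Qed.

Lemma ideal_add_is_ideal A B :
  is_ideal A -> is_ideal B -> is_ideal (ideal_add A B).
Proof.
move=> [A0 AD AM] [B0 BD BM]; split.
- by exists 0 => //; exists 0 => //; rewrite addr0.
- move=> _ _ [f Af [g Bg <-]] [f' Af' [g' Bg' <-]].
  by exists (f + f'); [exact: AD|exists (g + g'); [exact: BD|rewrite addrACA]].
- move=> h _ [f Af [g Bg <-]].
  by exists (h * f); [exact: AM|exists (h * g); [exact: BM|rewrite mulrDr]].
Qed.

Lemma ideal_add_subl A B : is_ideal B -> A `<=` ideal_add A B.
Proof. by case=> B0 _ _ f Af; exists f => //; exists 0; rewrite ?addr0. Qed.

Lemma ideal_add_subr A B : is_ideal A -> B `<=` ideal_add A B.
Proof. by case=> A0 _ _ f Bf; exists 0 => //; exists f; rewrite ?add0r. Qed.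

Lemma ideal_add_sub A B C :
  is_ideal C -> A `<=` C -> B `<=` C -> ideal_add A B `<=` C.
Proof.
by move=> [_ CD _] sAC sBC _ [f Af [g Bg <-]]; apply: CD; [apply: sAC|apply: sBC].
Qed.

Lemma ideal_sum A (T : eqType) (r : seq T) (F : T -> R) :
  is_ideal A -> (forall i, i \in r -> A (F i)) -> A (\sum_(i <- r) F i).
Proof.
move=> [A0 AD _]; elim: r => [|i r IH] AF; first by rewrite big_nil.
rewrite big_cons; apply: AD; first by apply: AF; rewrite mem_head.
by apply: IH => j jr; apply: AF; rewrite inE jr orbT.
Qed.

Lemma preimage_is_ideal (S : comNzRingType) (f : {rmorphism S -> R}) A :
  is_ideal A -> is_ideal (f @^-1` A).
Proof.
move=> [A0 AD AM]; split=> /= [|x y Ax Ay|x y Ay].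
- by rewrite rmorph0.
- by rewrite rmorphD; exact: AD.
- by rewrite rmorphM; exact: AM.
Qed.

End Ideals.

(** * Exponent vectors and upward closed sets of exponents *)

Section Multinomials.
Variable n : nat.
Implicit Types (U V S : set 'X_{1..n}) (a b c m : 'X_{1..n}).

Definition upward_closed U := forall m m', U m -> (m <= m')%MM -> U m'.

Definition up_closure S : set 'X_{1..n} :=
  [set m | exists2 s, S s & (s <= m)%MM].

Definition minimal U : set 'X_{1..n} :=
  [set m | U m /\ forall m', U m' -> (m' <= m)%MM -> m' = m].

Lemma up_closure_upward_closed S : upward_closed (up_closure S).
Proof. by move=> m m' [s Ss sm] mm'; exists s => //; apply: lepm_trans mm'. Qed.

Lemma addmAC : right_commutative (@mnm_add n).
Proof. exact: Monoid.mulmAC. Qed.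

Lemma mnm_subU_neq0 m : m != 0%MM -> exists i m', m = (m' + U_(i))%MM.
Proof.
rewrite -mdeg_eq0 mdegE sum_nat_eq0 negb_forall => /existsP[i /= mi].
by exists i, (m - U_(i))%MM; rewrite submK // lep1mP.
Qed.

Lemma mnm_ind (P : 'X_{1..n} -> Prop) :
  P 0%MM -> (forall m i, P m -> P (m + U_(i))%MM) -> forall m, P m.
Proof.
move=> P0 PS m; have [d] := ubnP (mdeg m); elim: d m => // d IH m.
have [->//|/mnm_subU_neq0[i [m' ->]]] := eqVneq m 0%MM.
by rewrite mdegD mdeg1 addn1 ltnS => /IH/PS.
Qed.

Lemma lepm_mdeg_eq m m' : (m <= m')%MM -> (mdeg m' <= mdeg m)%N -> m = m'.
Proof.
move=> /submK <-; rewrite mdegD -{2}[mdeg m]add0n leq_add2r leqn0 mdeg_eq0.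
by move/eqP->; rewrite add0m.
Qed.

Lemma exists_minimal U m : U m -> exists2 s, minimal U s & (s <= m)%MM.
Proof.
have [d] := ubnP (mdeg m); elim: d m => // d IH m /ltnSE md Um.
have [mU|] := pselect (minimal U m); first by exists m => //; exact: lepm_refl.
move=> /not_andP[//|/existsNP[m' /not_implyP[Um' /not_implyP[m'm neq]]]].
have [|s mins sm'] := IH m' _ Um'; last by exists s => //; apply: lepm_trans m'm.
apply: leq_trans md; rewrite ltnNge; apply/negP => le.
exact/neq/lepm_mdeg_eq.
Qed.

Lemma mdeg_coord m i : (m i <= mdeg m)%N.
Proof. by rewrite mdegE (bigD1 i) //= leq_addr. Qed.

(* Dickson's lemma, by induction on the number of variables involved. Dividing
   by a power of the last one leads to the projection of U, whose finitely many
   bounded elements lift to U with exponents below some V; above V the projection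
   decides, and below V each exponent has its own section of U. *)
Lemma dickson U : upward_closed U ->
  exists d, forall m, minimal U m -> (mdeg m <= d)%N.
Proof.
move=> upU.
(* The bounded [m'] need not be minimal, which suits the induction; for [k = n], a minimal [m] must
   coincide with its [m']. *)
suff H k : (k <= n)%N -> forall U, upward_closed U -> exists d, forall m, U m ->
    (forall i : 'I_n, (k <= i)%N -> m i = 0%N) ->
    exists m', [/\ U m', (m' <= m)%MM & (mdeg m' <= d)%N].
  have [d Hd] := H n (leqnn n) U upU; exists d => m [Um minm].
  have [|m' [Um' /(minm _ Um') <-//]] := Hd m Um.
  by move=> i; rewrite leqNgt ltn_ord.
elim: k => [_ {upU}U upU|k IH kn {upU}U upU].
  exists 0%N => m Um m0; exists m; split=> //; first exact: lepm_refl.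
  by rewrite mdegE big1 // => i _; exact: m0.
pose e := Ordinal kn.
pose sect v : set 'X_{1..n} := [set m | U (m + U_(e) *+ v)%MM].
have up_sect v : upward_closed (sect v).
  move=> m m' Um mm'; apply: upU Um _.
  by apply/mnm_lepP=> i; rewrite !mnmDE leq_add2r; apply/mnm_lepP.
have [d0 Hd0] : exists d, forall m, (exists v, sect v m) ->
    (forall i : 'I_n, (k <= i)%N -> m i = 0%N) ->
    exists m', [/\ exists v, sect v m', (m' <= m)%MM & (mdeg m' <= d)%N].
  apply: (IH (ltnW kn) [set m | exists v, sect v m]).
  by move=> m m' [v sm] mm'; exists v; apply: up_sect mm'.
have /choice[lift Hlift] (m : 'X_{1..n < d0.+1}) :
    exists v, (exists v, sect v m) -> sect v m.
  by have [[v]|] := pselect (exists v, sect v m); [exists v|exists 0%N].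
have /choice[d Hd] v := IH (ltnW kn) (sect v) (up_sect v).
pose V := (\max_(m : 'X_{1..n < d0.+1}) lift m)%N.
pose D := (\max_(v < V) (d v + v))%N.
(* [d0 + V] serves the exponents with [m e] at least [V], and [D] those below, where the section at
   [v] costs [d v] plus [v] for the restored variable. *)
exists (d0 + V + D)%N => m Um m0.
pose m1 := (m - U_(e) *+ m e)%MM.
have em : (m1 + U_(e) *+ m e)%MM = m.
  apply: submK; apply/mnm_lepP=> i; rewrite mulmnE mnm1E.
  by case: eqP => [->|_]; rewrite ?mul1n ?mul0n.
have m10 (i : 'I_n) : (k <= i)%N -> m1 i = 0%N.
  rewrite mnmBE mulmnE mnm1E; case: (eqVneq e i) => [<-|ne] ki.
    by rewrite mul1n subnn.
  rewrite mul0n subn0; apply: m0; rewrite ltn_neqAle ki andbT.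
  by apply: contraNneq ne => ek; apply/eqP/val_inj.
have [Vm|mV] := leqP V (m e).
  have [|m' [sm' m'm1 m'd]] := Hd0 m1 _ m10.
    by exists (m e); rewrite /sect /= em.
  have m'd' : (mdeg m' < d0.+1)%N by [].
  have := Hlift (BMultinom m'd') sm'; set v := lift _ => sv.
  have vV : (v <= V)%N by apply: leq_bigmax.
  exists (m' + U_(e) *+ v)%MM; split=> //.
    rewrite -em; apply/mnm_lepP=> i; rewrite !mnmDE !mulmnE leq_add ?leq_mul //.
      exact/mnm_lepP.
    exact: leq_trans Vm.
  by rewrite mdegD mdegMn mdeg1 mul1n -addnA leq_add // (leq_trans vV) ?leq_addr.
have [|m' [sm' m'm1 m'd]] := Hd (m e) m1 _ m10; first by rewrite /sect /= em.
exists (m' + U_(e) *+ m e)%MM; split=> //.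
  rewrite -[X in (_ <= X)%MM]em; apply/mnm_lepP=> i; rewrite !mnmDE leq_add2r.
  exact/mnm_lepP.
rewrite mdegD mdegMn mdeg1 mul1n (leq_trans _ (leq_addl _ _)) //.
apply: leq_trans (leq_bigmax (F := fun v : 'I_V => (d v + v)%N) (Ordinal mV)).
by rewrite /= leq_add2r.
Qed.

(** * Join, dual and product on exponent sets *)

Definition join_exps U V : set 'X_{1..n} :=
  [set m | forall b c, (b + c)%MM = m -> U b \/ V c].

Definition dual_exps a U : set 'X_{1..n} := [set m | ~ U (a - m)%MM].

Definition sum_exps U V : set 'X_{1..n} :=
  [set m | exists p q, [/\ U p, V q & (p + q <= m)%MM]].

(** A splitting of [m'] restricts to one of [m]: cut [b] down to its minimum with [m]; the
    complement in [m] is then at most [c]. *)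
Lemma join_exps_upward_closed U V :
  upward_closed U -> upward_closed V -> upward_closed (join_exps U V).
Proof.
move=> upU upV m m' Jm mm' b c bc.
pose b' := [multinom minn (b i) (m i) | i < n].
have b'b : (b' <= b)%MM by apply/mnm_lepP=> i; rewrite mnmE geq_minl.
have [|Ub'|Vc'] := Jm b' (m - b')%MM.
- by apply/mnmP=> i; rewrite mnmDE mnmBE mnmE; lia.
- by left; exact: upU b'b.
- right; apply: upV Vc' _; apply/mnm_lepP=> i; rewrite mnmBE mnmE.
  by move/mnm_lepP/(_ i): mm'; rewrite -bc mnmDE; lia.
Qed.

Lemma sum_exps_upward_closed U V : upward_closed (sum_exps U V).
Proof.
move=> m m' [p [q [Up Vq pqm]]] mm'; exists p, q; split=> //.
exact: lepm_trans mm'.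
Qed.

Definition meet_mnm a m := [multinom minn (m i) (a i) | i < n].

Lemma meet_mnm_lel a m : (meet_mnm a m <= a)%MM.
Proof. by apply/mnm_lepP=> i; rewrite mnmE geq_minr. Qed.

Lemma meet_mnm_ler a m : (meet_mnm a m <= m)%MM.
Proof. by apply/mnm_lepP=> i; rewrite mnmE geq_minl. Qed.

Lemma dual_exps_meet a U m : dual_exps a U m -> dual_exps a U (meet_mnm a m).
Proof.
rewrite /dual_exps /=; suff -> : (a - meet_mnm a m = a - m)%MM by [].
by apply/mnmP=> i; rewrite !mnmBE mnmE; lia.
Qed.

Lemma lepmD m1 m2 m3 m4 :
  (m1 <= m2 -> m3 <= m4 -> m1 + m3 <= m2 + m4)%MM.
Proof.
move=> /mnm_lepP h /mnm_lepP h'; apply/mnm_lepP=> i.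
by rewrite !mnmDE leq_add.
Qed.

(** Truncated subtraction makes [a - p] insensitive to the part of [p] above [a]. Cutting both
    summands at [a] therefore stays in the duals, and by minimality changes nothing. This is the
    bound required for dualizing the product with respect to [a + a]. *)
Lemma minimal_sum_dual_exps a U V m :
  minimal (sum_exps (dual_exps a U) (dual_exps a V)) m -> (m <= a + a)%MM.
Proof.
move=> [[p [q [Up Vq pqm]]] minm].
rewrite -(minm (meet_mnm a p + meet_mnm a q)%MM).
- by apply: lepmD; exact: meet_mnm_lel.
- exists (meet_mnm a p), (meet_mnm a q).
  by split; [exact: dual_exps_meet|exact: dual_exps_meet|exact: lepm_refl].
- by apply: lepm_trans pqm; apply: lepmD; exact: meet_mnm_ler.
Qed.

Lemma dual_sum_dual_exps a U V m :
    upward_closed U -> upward_closed V -> (m <= a)%MM ->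
  dual_exps (a + a) (sum_exps (dual_exps a U) (dual_exps a V)) m <->
  join_exps U V m.
Proof.
move=> upU upV /mnm_lepP ma; split=> [Dm b c bc|Jm [p [q [Up Vq pq]]]].
  apply: contrapT => /not_orP[nUb nVc]; apply: Dm.
  have bi i : (b i + c i = m i)%N by rewrite -bc mnmDE.
  (* Since [b] and [c] are below [m], hence below [a], complementing twice in [a] gives them
     back. *)
  exists (a - b)%MM, (a - c)%MM; split.
  - rewrite /dual_exps /=; suff -> : (a - (a - b) = b)%MM by [].
    by apply/mnmP=> i; rewrite !mnmBE; have := ma i; have := bi i; lia.
  - rewrite /dual_exps /=; suff -> : (a - (a - c) = c)%MM by [].
    by apply/mnmP=> i; rewrite !mnmBE; have := ma i; have := bi i; lia.
  - apply/mnm_lepP=> i; rewrite !(mnmBE, mnmDE).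
    by have := ma i; have := bi i; lia.
(* From [p + q <= 2a - m] it follows that [(a - p) + (a - q)] lies above [m], so it belongs to the
   join as well; this very splitting contradicts the choice of [p] and [q]. *)
have [] // :=
  join_exps_upward_closed upU upV Jm (m' := (a - p + (a - q))%MM) _ erefl.
apply/mnm_lepP=> i; move/mnm_lepP/(_ i): pq; rewrite !(mnmBE, mnmDE).
by have := ma i; lia.
Qed.

End Multinomials.

(** * Monomial ideals as spans of exponent sets *)

Section MonomialIdeals.
Variables (K : fieldType) (n : nat).
Implicit Types (U V S : set 'X_{1..n}) (a b c m : 'X_{1..n}).

(** Testing membership on the support turns each operation on monomial ideals into one on exponent
    sets. The span is an ideal once [U] is upward closed. *)
Definition mon_span U : set {mpoly K[n]} :=
  [set f | forall m, m \in msupp f -> U m].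

Lemma mon_spanX U m : mon_span U 'X_[m] <-> U m.
Proof.
by split=> [|Um m']; [apply|]; rewrite msuppX mem_seq1 // => /eqP->.
Qed.

Lemma mon_span_is_ideal U : upward_closed U -> is_ideal (mon_span U).
Proof.
move=> upU; split=> [m|f g Uf Ug m|f g Ug m]; first by rewrite msupp0.
  by move/msuppD_le; rewrite mem_cat => /orP[/Uf|/Ug].
move/msuppM_le => /allpairsP[[p q] [/= _ /Ug Uq ->]].
exact: upU Uq (lem_addl _ _).
Qed.

Lemma mon_span_sub U (A : set {mpoly K[n]}) : is_ideal A ->
  (forall m, U m -> A 'X_[m]) -> mon_span U `<=` A.
Proof.
move=> iA UA f Uf; rewrite [f]mpolyE; apply: ideal_sum => // m /Uf/UA.
by rewrite -mul_mpolyC; case: iA => _ _; apply.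
Qed.

Lemma ideal_gen_mon_span U (G : set {mpoly K[n]}) : upward_closed U ->
    G `<=` mon_span U -> (forall m, U m -> ideal_gen G 'X_[m]) ->
  ideal_gen G = mon_span U.
Proof.
move=> upU GU UG; apply/seteqP; split.
  by apply: ideal_gen_sub => //; exact: mon_span_is_ideal.
by apply: mon_span_sub => //; exact: ideal_gen_is_ideal.
Qed.

Lemma ideal_gen_monomials S :
  ideal_gen [set ('X_[m] : {mpoly K[n]}) | m in S] = mon_span (up_closure S).
Proof.
apply: ideal_gen_mon_span; first exact: up_closure_upward_closed.
  by move=> _ [m Sm <-]; apply/mon_spanX; exists m => //; exact: lepm_refl.
move=> m [s Ss /submK <-]; rewrite mpolyXD.
have [_ _] := ideal_gen_is_ideal [set ('X_[m] : {mpoly K[n]}) | m in S]; apply.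
by apply: sub_gen_smallest; exists s.
Qed.

Lemma min_gens_mon_span U : min_gens (mon_span U) = minimal U.
Proof.
apply/seteqP; split=> m [Um minm]; split; try exact/mon_spanX.
  by move=> m' Um'; apply: minm; exact/mon_spanX.
by move=> m' /mon_spanX; exact: minm.
Qed.

Lemma irr_idealE (u : 'X_{1..n}) :
  irr_ideal u =
    mon_span [set m | exists2 i, (0 < u i)%N & (u i <= m i)%N]
    :> set {mpoly K[n]}.
Proof.
rewrite [X in mon_span X](_ : _ = up_closure
    [set (U_(i) *+ u i)%MM | i in [set i : 'I_n | (0 < u i)%N]]); last first.
  apply/seteqP; split=> m /=.
    move=> [i ui um]; exists (U_(i) *+ u i)%MM; first by exists i.
    apply/mnm_lepP=> j; rewrite mulmnE mnm1E.
    by case: eqP => [<-|_]; rewrite ?mul1n.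
  move=> [_ [i ui <-] /mnm_lepP/(_ i)].
  by rewrite mulmnE mnm1E eqxx mul1n; exists i.
rewrite -ideal_gen_monomials image_comp; congr ideal_gen.
by apply: eq_imagel => i _ /=; rewrite mpolyXn.
Qed.

(** For [b <= a], [m] lies outside the irreducible component of [b] iff [m i < a i + 1 - b i]
    wherever [b i > 0], that is, iff [b <= a - m]. So [m] lies in all components iff no minimal [b]
    is below [a - m]. *)
Lemma alexander_dual_mon_span a U : upward_closed U ->
    (forall b, minimal U b -> (b <= a)%MM) ->
  alexander_dual a (mon_span U) = mon_span (dual_exps a U).
Proof.
move=> upU Ua; rewrite /alexander_dual min_gens_mon_span.
apply/seteqP; split=> f Af.
  move=> m fm Uam; have [b minb /mnm_lepP bam] := exists_minimal Uam.
  have := Af b minb; rewrite irr_idealE => /(_ m fm)[i].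
  rewrite mnmE; have := bam i; rewrite mnmBE; case: eqP => //; lia.
move=> b minb; rewrite irr_idealE => m fm.
apply: contrapT => H; apply: (Af m fm); case: (minb) => Ub _; apply: upU Ub _.
(* If [b i] exceeds the truncated [a i - m i], then [b i] is nonzero, and [b i <= a i] makes
   [a i + 1 - b i] a positive exponent, which is at most [m i]. *)
apply/mnm_lepP=> i; rewrite mnmBE leqNgt; apply/negP => lt; apply: H; exists i.
all: by rewrite mnmE; move/mnm_lepP/(_ i): (Ua b minb); case: eqP; lia.
Qed.

Lemma ideal_mul_mon_span U V :
  ideal_mul (mon_span U) (mon_span V) = mon_span (sum_exps U V).
Proof.
apply: ideal_gen_mon_span; first exact: sum_exps_upward_closed.
  move=> _ [f Uf [g Vg <-]] m /msuppM_le/allpairsP[[p q] /= [/Uf Up /Vg Vq ->]].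
  by exists p, q; split=> //; exact: lepm_refl.
move=> m [p [q [Up Vq /submK <-]]]; rewrite mpolyXD.
have [_ _] := ideal_gen_is_ideal [set f * g | f in mon_span U & g in mon_span V].
apply; apply: sub_gen_smallest; rewrite mpolyXD.
by exists 'X_[p]; [apply/mon_spanX|exists 'X_[q]; [apply/mon_spanX|]].
Qed.

Lemma ideal_modulo_mon_span a U :
  ideal_modulo a (mon_span U) =
  mon_span (up_closure (minimal U `&` [set m | (m <= a)%MM])).
Proof.
rewrite -ideal_gen_monomials /ideal_modulo min_gens_mon_span.
congr (ideal_gen (image _ _)); apply/seteqP; split=> m [minm ma]; split=> //.
  apply/mnm_lepP=> i; rewrite leqNgt; apply: contra (ma i) => lt.
  apply/mnm_lepP=> j; rewrite mulmnE mnm1E addn1.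
  by case: eqP => [<-|_]; rewrite ?mul1n.
move=> i; apply/negP => /mnm_lepP/(_ i); rewrite mulmnE mnm1E eqxx mul1n addn1.
by rewrite ltnNge; move/mnm_lepP: ma => ->.
Qed.

End MonomialIdeals.

(** * The join of two monomial ideals *)

Section Join.
Variables (K : fieldType) (n : nat).
Implicit Types (U V : set 'X_{1..n}) (b c m : 'X_{1..n}) (f : {mpoly K[n]}).
Implicit Types (v : 'I_n -> {mpoly K[n + (n + n)]}) (M : 'X_{1..n + (n + n)}).

Let y1 (i : 'I_n) : 'I_(n + (n + n)) := rshift n (lshift n i).
Let y2 (i : 'I_n) : 'I_(n + (n + n)) := rshift n (rshift n i).

Lemma subst_vars0 v : subst_vars v 'X_[0] = 1.
Proof. by rewrite /subst_vars mpolyX0 rmorph1. Qed.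

Lemma subst_varsXD v m i :
  subst_vars v 'X_[m + U_(i)] = subst_vars v 'X_[m] * v i.
Proof.
by rewrite /subst_vars mpolyXD rmorphM /= comp_mpolyXU -tnth_nth tnth_mktuple.
Qed.

Lemma subst_varsE v f :
  subst_vars v f = \sum_(m <- msupp f) f@_m *: subst_vars v 'X_[m].
Proof.
rewrite {1}[f]mpolyE /subst_vars raddf_sum /=.
by apply: eq_bigr => m _; rewrite comp_mpolyZ.
Qed.

(** The exponent of the monomial y1^b y2^c, free of x. *)
Definition ypair b c : 'X_{1..n + (n + n)} :=
  [multinom match split k with
            | inl _ => 0%N
            | inr j => match split j with inl i => b i | inr i => c i end
            end | k < n + (n + n)].

Definition y1part M : 'X_{1..n} := [multinom M (y1 i) | i < n].
Definition y2part M : 'X_{1..n} := [multinom M (y2 i) | i < n].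

Lemma y1part_ypair b c : y1part (ypair b c) = b.
Proof. by apply/mnmP=> i; rewrite !mnmE (unsplitK (inr _)) (unsplitK (inl _)). Qed.

Lemma y2part_ypair b c : y2part (ypair b c) = c.
Proof. by apply/mnmP=> i; rewrite !mnmE (unsplitK (inr _)) (unsplitK (inr _)). Qed.

Lemma ypair_subl b c i : (ypair b c - U_(y1 i))%MM = ypair (b - U_(i)) c.
Proof.
apply/mnmP=> k; rewrite !mnmE; case: splitP => j kj.
  case: eqP => // /(congr1 val) /= e; have := ltn_ord j; lia.
case: splitP => l jl.
  rewrite mnmBE mnm1E; congr (_ - nat_of_bool _)%N.
  by apply/eqP/eqP => [/(congr1 val)/= e|->]; apply/val_inj => /=; lia.
by case: eqP => [/(congr1 val)/=|]; have := ltn_ord i; lia.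
Qed.

Lemma ypair_subr b c i : (ypair b c - U_(y2 i))%MM = ypair b (c - U_(i)).
Proof.
apply/mnmP=> k; rewrite !mnmE; case: splitP => j kj.
  case: eqP => // /(congr1 val) /= e; have := ltn_ord j; lia.
case: splitP => l jl.
  by case: eqP => [/(congr1 val)/=|]; have := ltn_ord l; lia.
rewrite mnmBE mnm1E; congr (_ - nat_of_bool _)%N.
by apply/eqP/eqP => [/(congr1 val)/= e|->]; apply/val_inj => /=; lia.
Qed.

Lemma mcoeffMXU (R : comNzRingType) k (g : {mpoly R[k]}) (j : 'I_k)
    (M : 'X_{1..k}) :
  (g * 'X_j)@_M = if (0 < M j)%N then g@_(M - U_(j)) else 0.
Proof.
case: ifPn => [|Mj].
  by rewrite lt0n -lep1mP => /submK {1}<-; rewrite addmC mcoeffMX.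
apply/eqP; rewrite mcoeff_eq0 (perm_mem (msuppMX _ _)).
apply: contra Mj => /mapP[M' _ ->].
by rewrite mnmDE mnm1E eqxx.
Qed.

Definition yvar_sum (i : 'I_n) : {mpoly K[n + (n + n)]} := y1var K i + y2var K i.

(* The coefficient is the product of the binomials m_i over b_i when b + c = m;
   only its positivity matters. *)
Lemma mcoeff_yvar_sum m b c : exists k : nat,
  (subst_vars yvar_sum 'X_[m])@_(ypair b c) = k%:R /\
  (0 < k)%N = ((b + c)%MM == m).
Proof.
elim/mnm_ind: m b c => [|m i IH] b c.
  rewrite subst_vars0 mcoeff1; exists (ypair b c == 0%MM); split=> //.
  rewrite lt0b; apply/eqP/eqP => [e|/eqP].
    apply/mnmP=> i; rewrite mnmDE -{1}(y1part_ypair b c) -{2}(y2part_ypair b c).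
    by rewrite e !mnmE.
  rewrite mnmD_eq0 => /andP[/eqP-> /eqP->]; apply/mnmP=> k; rewrite !mnmE.
  by case: splitP => // j _; case: splitP => l _; rewrite mnm0E.
rewrite subst_varsXD mulrDr mcoeffD !mcoeffMXU ypair_subl ypair_subr.
rewrite -[ypair b c (y1 i)](mnmE (fun i => ypair b c (y1 i))).
rewrite -[ypair b c (y2 i)](mnmE (fun i => ypair b c (y2 i))).
rewrite -/(y1part _) -/(y2part _) y1part_ypair y2part_ypair.
have [k1 [-> k1E]] := IH (b - U_(i))%MM c.
have [k2 [-> k2E]] := IH b (c - U_(i))%MM.
(* Pascal's rule; the guards discard the terms in which [b - U_(i)] or [c - U_(i)] would be
   truncated. *)
exists ((if (0 < b i)%N then k1 else 0) + (if (0 < c i)%N then k2 else 0))%N.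
split; first by rewrite natrD; do 2 case: ifP.
have addU : (0 < b i)%N -> ((b - U_(i)) + c == m)%MM = (b + c == m + U_(i))%MM.
  rewrite lt0n -lep1mP => /submK {2}<-.
  by rewrite addmAC eqm_add2r.
have addU' : (0 < c i)%N -> (b + (c - U_(i)) == m)%MM = (b + c == m + U_(i))%MM.
  rewrite lt0n -lep1mP => /submK {2}<-.
  by rewrite addmA eqm_add2r.
rewrite addn_gt0; case: ifP => [bi|/negbT bi]; case: ifP => [ci|/negbT ci].
- by rewrite k1E k2E addU' // addU // orbb.
- by rewrite k1E orbF addU.
- by rewrite k2E addU'.
- apply/esym/eqP => /mnmP/(_ i); rewrite !mnmDE mnm1E eqxx; lia.
Qed.

(** No cancellation occurs: y1^b y2^c arises only from the monomial [b + c] of [f], and there its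
    coefficient is a positive integer, nonzero in characteristic 0. *)
Lemma subst_yvar_sum_supp (charK0 : [pchar K] =i pred0) f b c :
  (b + c)%MM \in msupp f -> ypair b c \in msupp (subst_vars yvar_sum f).
Proof.
rewrite !mcoeff_msupp subst_varsE raddf_sum /= => fbc.
have [k [e]] := mcoeff_yvar_sum (b + c)%MM b c; rewrite eqxx => k_gt0.
rewrite (bigD1_seq (b + c)%MM) ?msupp_uniq ?mcoeff_msupp //= mcoeffZ e big1.
  by rewrite addr0 mulf_neq0 // ((pcharf0P _).1 charK0) -lt0n.
move=> m; have [k' [e' k'E]] := mcoeff_yvar_sum m b c.
rewrite eq_sym -k'E lt0n negbK mcoeffZ e' => /eqP->.
by rewrite mulr0.
Qed.

(* The substitution x |-> y1 + y2, which kills the generators y1 + y2 - x of the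
   join and fixes K[y1, y2]. *)
Definition elim_x : (n + (n + n)).-tuple {mpoly K[n + (n + n)]} :=
  [tuple match split k with
         | inl i => yvar_sum i
         | inr j => 'X_(rshift n j)
         end | k < n + (n + n)].

Lemma elim_xvar i : xvar K i \mPo elim_x = yvar_sum i.
Proof. by rewrite comp_mpolyXU -tnth_nth tnth_mktuple (unsplitK (inl _)). Qed.

Lemma elim_x_yvar (j : 'I_(n + n)) : 'X_(rshift n j) \mPo elim_x = 'X_(rshift n j).
Proof. by rewrite comp_mpolyXU -tnth_nth tnth_mktuple (unsplitK (inr _)). Qed.

Lemma elim_x_subst v w f : (forall i, v i \mPo elim_x = w i) ->
  subst_vars v f \mPo elim_x = subst_vars w f.
Proof.
move=> vw; rewrite subst_varsE [RHS]subst_varsE raddf_sum /=.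
apply: eq_bigr => m _; rewrite comp_mpolyZ; congr (_ *: _).
elim/mnm_ind: m => [|m i IH]; first by rewrite !subst_vars0 rmorph1.
by rewrite !subst_varsXD rmorphM /= IH vw.
Qed.

Lemma y1part_le M M' : (M <= M')%MM -> (y1part M <= y1part M')%MM.
Proof. by move/mnm_lepP=> le; apply/mnm_lepP=> i; rewrite !mnmE. Qed.

Lemma y2part_le M M' : (M <= M')%MM -> (y2part M <= y2part M')%MM.
Proof. by move/mnm_lepP=> le; apply/mnm_lepP=> i; rewrite !mnmE. Qed.

Lemma subst_y1varX m : subst_vars (y1var K (n:=n)) 'X_[m] = 'X_[ypair m 0].
Proof.
elim/mnm_ind: m => [|m i IH].
  rewrite subst_vars0 -mpolyX0; congr 'X_[_]; apply/mnmP=> k; rewrite !mnmE.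
  by case: splitP => // j _; case: splitP => l _; rewrite mnm0E.
rewrite subst_varsXD IH -mpolyXD; congr 'X_[_].
(* Writing [m] as [(m + U_(i)) - U_(i)] brings the subtraction rule for [ypair] into play. *)
rewrite -[m in LHS](addmK U_(i)) -ypair_subl submK // lep1mP.
by rewrite mnmE (unsplitK (inr _)) (unsplitK (inl _)) mnmDE mnm1E eqxx addn1.
Qed.

Lemma subst_y2varX m : subst_vars (y2var K (n:=n)) 'X_[m] = 'X_[ypair 0 m].
Proof.
elim/mnm_ind: m => [|m i IH].
  rewrite subst_vars0 -mpolyX0; congr 'X_[_]; apply/mnmP=> k; rewrite !mnmE.
  by case: splitP => // j _; case: splitP => l _; rewrite mnm0E.
rewrite subst_varsXD IH -mpolyXD; congr 'X_[_].
rewrite -[m in LHS](addmK U_(i)) -ypair_subr submK // lep1mP.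
by rewrite mnmE (unsplitK (inr _)) (unsplitK (inr _)) mnmDE mnm1E eqxx addn1.
Qed.

(** Eliminating x sends the join into the monomial ideal generated by I(y1) and J(y2), and [f] to
    f(y1 + y2). Every splitting of an exponent of [f] shows up in the support of the latter. *)
Lemma ideal_join_sub (charK0 : [pchar K] =i pred0) U V :
    upward_closed U -> upward_closed V ->
  ideal_join (mon_span U) (mon_span V) `<=`
    (mon_span (join_exps U V) : set {mpoly K[n]}).
Proof.
move=> upU upV f; rewrite /ideal_join /= => fJ.
pose Y : set 'X_{1..n + (n + n)} := [set M | U (y1part M) \/ V (y2part M)].
have upY : upward_closed Y.
  move=> M M' [UM|VM] le; [left|right].
    exact: upU UM (y1part_le le).
  exact: upV VM (y2part_le le).
have iY : is_ideal (mon_span Y : set {mpoly K[n + (n + n)]}).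
  exact: mon_span_is_ideal.
(* The preimage under the elimination is an ideal, so only the three kinds of generators have to be
   checked. *)
have iW := preimage_is_ideal (comp_mpoly elim_x) iY.
have [Y0 _ YM] := iY.
have : mon_span Y (subst_vars (xvar K (n:=n)) f \mPo elim_x).
  move: (subst_vars _ f) fJ.
  apply: (ideal_add_sub iW); first apply: (ideal_add_sub iW).
  - apply: ideal_gen_sub => // _ [g Ug <-].
    rewrite /= (elim_x_subst (w := y1var K (n:=n))); last first.
      by move=> i; exact: elim_x_yvar.
    rewrite subst_varsE; apply: ideal_sum => // m /Ug Um.
    rewrite -mul_mpolyC; apply: YM; rewrite subst_y1varX; apply/mon_spanX.
    by left; rewrite y1part_ypair.
  - apply: ideal_gen_sub => // _ [g Vg <-].
    rewrite /= (elim_x_subst (w := y2var K (n:=n))); last first.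
      by move=> i; exact: elim_x_yvar.
    rewrite subst_varsE; apply: ideal_sum => // m /Vg Vm.
    rewrite -mul_mpolyC; apply: YM; rewrite subst_y2varX; apply/mon_spanX.
    by right; rewrite y2part_ypair.
  - apply: ideal_gen_sub => // _ [i _ <-].
    by rewrite /= comp_mpolyB comp_mpolyD elim_xvar !elim_x_yvar subrr.
rewrite (elim_x_subst (w := yvar_sum)); last exact: elim_xvar.
move=> Yf m fm b c bc; rewrite -bc in fm.
have [] := Yf _ (subst_yvar_sum_supp charK0 fm).
  by rewrite y1part_ypair; left.
by rewrite y2part_ypair; right.
Qed.

(** Modulo the linear generators each x_i equals y1_i + y2_i, so x^m reduces to a combination of the
    y1^b y2^c with [b + c = m], each of which lies in I(y1) or J(y2). *)
Lemma mon_span_sub_ideal_join U V :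
  (mon_span (join_exps U V) : set {mpoly K[n]}) `<=`
    ideal_join (mon_span U) (mon_span V).
Proof.
pose B : set {mpoly K[n + (n + n)]} :=
  ideal_add (ideal_subst (y1var K (n:=n)) (mon_span U))
            (ideal_subst (y2var K (n:=n)) (mon_span V)).
pose C := ideal_gen [set y1var K i + y2var K i - xvar K i | i in [set: 'I_n]].
have iB : is_ideal B by apply: ideal_add_is_ideal; exact: ideal_gen_is_ideal.
have iC : is_ideal C by exact: ideal_gen_is_ideal.
have iA := ideal_add_is_ideal iB iC; have [_ AD AM] := iA.
apply: mon_span_sub; first exact: (preimage_is_ideal (comp_mpoly _) iA).
move=> m Jm; change (ideal_add B C (subst_vars (xvar K (n:=n)) 'X_[m])).
rewrite -[subst_vars _ _]mul1r.
(* The cofactor [h] collects the variables x_i already split off during the induction on [m']. *)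
suff H h m' : (forall b c, (b + c)%MM = m' ->
      ideal_add B C (h * (subst_vars (y1var K (n:=n)) 'X_[b] *
                          subst_vars (y2var K (n:=n)) 'X_[c]))) ->
    ideal_add B C (h * subst_vars (xvar K (n:=n)) 'X_[m']).
  apply: H => b c /Jm; rewrite mul1r => -[Ub|Vc]; apply: ideal_add_subl => //.
    apply: ideal_add_subl; first exact: ideal_gen_is_ideal.
    rewrite mulrC.
    have [_ _] := ideal_gen_is_ideal (subst_vars (y1var K (n:=n)) @` mon_span U).
    apply.
    by apply: sub_gen_smallest; exists 'X_[b] => //; apply/mon_spanX.
  apply: ideal_add_subr; first exact: ideal_gen_is_ideal.
  have [_ _] := ideal_gen_is_ideal (subst_vars (y2var K (n:=n)) @` mon_span V).
  apply.
  by apply: sub_gen_smallest; exists 'X_[c] => //; apply/mon_spanX.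
elim/mnm_ind: m' h => [|m' i IH] h Hh.
  by have := Hh 0%MM 0%MM (addm0 _); rewrite !subst_vars0 mulr1.
rewrite subst_varsXD [_ * xvar K i]mulrC mulrA; apply: IH => b c bc.
set Yb := subst_vars _ _; set Yc := subst_vars _ _.
have -> : h * xvar K i * (Yb * Yc) =
    h * (Yb * y1var K i * Yc) + h * (Yb * (Yc * y2var K i)) +
    (- h * (Yb * Yc)) * (y1var K i + y2var K i - xvar K i) by ring.
apply: (AD); first apply: (AD).
- by rewrite -subst_varsXD; apply: Hh; rewrite addmAC bc.
- by rewrite -subst_varsXD; apply: Hh; rewrite addmA bc.
- apply: AM; apply: ideal_add_subr => //; apply: sub_gen_smallest.
  by exists i.
Qed.

Lemma ideal_join_mon_span (charK0 : [pchar K] =i pred0) U V :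
    upward_closed U -> upward_closed V ->
  ideal_join (mon_span U) (mon_span V) =
    (mon_span (join_exps U V) : set {mpoly K[n]}).
Proof.
move=> upU upV; apply/seteqP; split; first exact: ideal_join_sub.
exact: mon_span_sub_ideal_join.
Qed.

End Join.

(** * Comparison of both sides for large [a] *)

Theorem theorem2p6 (K : fieldType) (n : nat) (I J : set {mpoly K[n]})
    (charK0 : ([pchar K] =i pred0)%R)
    (monI : monomial_ideal I) (monJ : monomial_ideal J) :
  exists a0 : 'X_{1..n}, forall a : 'X_{1..n}, (a0 <= a)%MM ->
    ideal_join I J =
    ideal_modulo a
      (alexander_dual (a + a)%MM
         (ideal_mul (alexander_dual a I) (alexander_dual a J))).
Proof.
have [S ->] := monI; have [T ->] := monJ.
rewrite !ideal_gen_monomials.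
have := up_closure_upward_closed (S := S); move: (up_closure S) => U upU.
have := up_closure_upward_closed (S := T); move: (up_closure T) => V upV.
have upJ := join_exps_upward_closed upU upV.
have [dU HU] := dickson upU; have [dV HV] := dickson upV.
have [dJ HJ] := dickson upJ.
(* A coordinate never exceeds the total degree, so the three degree bounds from Dickson's lemma
   bound every coordinate of the minimal exponents of [U], [V] and the join. *)
exists [multinom maxn dU (maxn dV dJ) | i < n] => a /mnm_lepP a0a.
have bnd d m : (d <= maxn dU (maxn dV dJ))%N -> (mdeg m <= d)%N -> (m <= a)%MM.
  move=> dmax md; apply/mnm_lepP=> i; have := a0a i; rewrite mnmE.
  by have := mdeg_coord m i; lia.
have bU m : minimal U m -> (m <= a)%MM by move/HU; apply: bnd; lia.
have bV m : minimal V m -> (m <= a)%MM by move/HV; apply: bnd; lia.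
have bJ m : minimal (join_exps U V) m -> (m <= a)%MM by move/HJ; apply: bnd; lia.
rewrite ideal_join_mon_span // !alexander_dual_mon_span // ideal_mul_mon_span.
have upP := @sum_exps_upward_closed _ (dual_exps a U) (dual_exps a V).
rewrite alexander_dual_mon_span //; last exact: minimal_sum_dual_exps.
rewrite ideal_modulo_mon_span; congr mon_span; apply/seteqP; split=> m.
  (* The two exponent sets are only known to agree below [a]. This suffices to transfer minimality,
     as every competitor of [s] lies below [s], hence below [a]. *)
  move=> /exists_minimal[s mins sm]; exists s => //; have sa := bJ s mins.
  case: mins => Js mins; split=> //; split; first exact/dual_sum_dual_exps.
  move=> m' Dm' m's; apply: mins => //.
  by apply/(dual_sum_dual_exps upU upV (lepm_trans m's sa)).
move=> [s [[Ds _] sa] sm]; apply: upJ sm.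
exact/(dual_sum_dual_exps upU upV sa).
Qed.
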